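(* Let $\mathcal{M}=(S,A,d_{\mathrm{init}},\delta)$ be an MDP, let $(T,\pi)$ be an MEC-closed sub-MDP of $\mathcal{M}$, and let $G(T,\pi)=(V,E)$. Then $\texttt{MEC-Decomp-Interleave}(V,E,\{v\})$, where $\{v\}=v_{\mathrm{arb}}$ or $v\in V$, outputs the graphs of all MECs in $\mathrm{MECs}_{\mathcal{M}}(T)$.
   Context: **MDPs.** An MDP is $\mathcal{M}=(S,A,d_{\mathrm{init}},\delta)$ with $S$ a finite non-empty set of states, $A$ a finite set of actions, $d_{\mathrm{init}}:S\to[0,1]$ a probability distribution on $S$, and $\delta:S\times A\times S\to[0,1]$ with $\sum_{s'\in S}\delta(s,\alpha,s')\in\{0,1\}$ for all $s\in S$, $\alpha\in A$. Action $\alpha$ is enabled in $s$ if this sum is $1$; $A[s]$ is the set of actions enabled in $s$. It is assumed that $A[s]\neq\emptyset$ for all $s$ and $\bigcup_{s}A[s]=A$. **Sub-MDPs.** A sub-MDP of $\mathcal{M}$ is a pair $(T,\pi)$ with $\emptyset\ne T\subseteq S$ and $\pi:T\to 2^A$ such that (a) $\emptyset\neq\pi(s)\subseteq A[s]$ for all $s\in T$, and (b) for all $s\in T$, $\alpha\in\pi(s)$, $s'\in S$: $\delta(s,\alpha,s')>0$ implies $s'\in T$. Its graph is the labelled directed graph $G(T,\pi)=(V,E)$ with $V=T$, $E=\{(s,\alpha,s')\in T\times A\times T \mid \alpha\in\pi(s),\ \delta(s,\alpha,s')>0\}$. Its state-action pair set is $\mathrm{sa}(T,\pi)=\{(s,\alpha)\in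 T\times A\mid \alpha\in\pi(s)\}$. Inclusion $(T_1,\pi_1)\subseteq(T_2,\pi_2)$ means $T_1\subseteq T_2$ and $\pi_1(s)\subseteq\pi_2(s)$ for all $s\in T_1$. **MECs.** An end-component is a sub-MDP $(T,\pi)$ such that for all $s,t\in T$ there is a sequence $s_0,\alpha_0,s_1,\alpha_1,\dots,s_n$ with $s_i\in T$, $s_0=s$, $s_n=t$, $\alpha_i\in\pi(s_i)$ and $\delta(s_i,\alpha_i,s_{i+1})>0$ for $0\le i<n$. A maximal end-component (MEC) is an end-component that is maximal for inclusion. Every state lies in at most one MEC; $\mathrm{MEC}_{\mathcal{M}}(s)$ denotes the MEC containing $s$, if it exists. For $S'\subseteq S$, $\mathrm{MECs}_{\mathcal{M}}(S')=\{\mathrm{MEC}_{\mathcal{M}}(s)\mid s\in S',\ s\text{ lies in an MEC}\}$. A sub-MDP $(T,\pi)$ is MEC-closed if for every $s\in T$, $\mathrm{MEC}_{\mathcal{M}}(s)$, if it exists, satisfies $\mathrm{MEC}_{\mathcal{M}}(s)\subseteq(T,\pi)$. **ROut and Attr.** For a sub-MDP $(T,\pi)$ and $U\subseteq T$, $\mathrm{ROut}_{(T,\pi)}(U)=\{(s,\alpha)\in U\times A\mid \alpha\in\pi(s),\ \exists s'\in T\setminus U:\delta(s,\alpha,s')>0\}$. For $X\subseteq\mathrm{sa}(T,\pi)$, $\mathrm{Attr}_{(T,\pi)}(X)=(\bigcup_{i}S_i,\bigcup_i X_i)$ where $X_0=X$, $S_0=\{s\in T\mid\forall\alpha\in\pi(s):(s,\alpha)\in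 X_0\}$, and for $i>0$, $X_i=X_{i-1}\cup\{(s,\alpha)\in\mathrm{sa}(T,\pi)\mid\exists s'\in S_{i-1}:\delta(s,\alpha,s')>0\}$, $S_i=S_{i-1}\cup\{s\in T\mid\forall\alpha\in\pi(s):(s,\alpha)\in X_i\}$. **Algorithm** $\texttt{MEC-Decomp-Interleave}(V,E,\{v\})$. Input: $(V,E)=G(T,\pi)$ for a sub-MDP $(T,\pi)$ of $\mathcal{M}$ and, optionally, a start vertex $v\in V$; if none is given, the third argument is the symbol $v_{\mathrm{arb}}$. Specified output: $\{G(T',\pi')\mid(T',\pi')\in\mathrm{MECs}_{\mathcal{M}}(T)\}$. 1. If the third argument is $v_{\mathrm{arb}}$, let $v$ be an arbitrary vertex of $V$. 2. Compute $F_v$ (the set of vertices reachable from $v$ in $(V,E)$), a vertex $v'$ at maximum distance from $v$, and $C_v$ (the SCC of $v$), as follows. Start with $F=\emptyset$, $L_0=\emptyset$, $L_1=\{v\}$; while $L_1\neq\emptyset$: $F\gets F\cup L_1$, $L_0\gets L_1$, $L_1\gets\mathrm{Post}(L_1)\setminus F$. Then $F_v=F$ and $v'$ is an arbitrary element of $L_0$. Start with $C=\{v\}$; while $\mathrm{Pre}(C)\cap F_v\not\subseteq C$: $C\gets C\cup(\mathrm{Pre}(C)\cap F_v)$. Then $C_v=C$. Here $\mathrm{Post}(U)=\{w\in V\mid\exists u\in U,\alpha:(u,\alpha,w)\in E\}$ and $\mathrm{Pre}(U)=\{w\in V\mid\exists u\in U,\alpha:(w,\alpha,u)\in E\}$.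 3. Let $(U_1,X_1)=\mathrm{Attr}_{(T,\pi)}(\mathrm{ROut}_{(T,\pi)}(C_v))$. If $X_1=\emptyset$, output $(C_v,E\cap(C_v\times A\times C_v))$ as an MEC. Otherwise let $E_1=E\setminus(X_1\times V)$, $V_1=C_v\setminus U_1$, and if $V_1\ne\emptyset$ call $\texttt{MEC-Decomp-Interleave}(V_1,E_1\cap(V_1\times A\times V_1),v_{\mathrm{arb}})$. 4. Let $V_2=F_v\setminus C_v$. If $V_2\neq\emptyset$, call $\texttt{MEC-Decomp-Interleave}(V_2,E\cap(V_2\times A\times V_2),\{v'\})$. 5. Let $(U_3,X_3)=\mathrm{Attr}_{(T,\pi)}(\mathrm{ROut}_{(T,\pi)}(V\setminus F_v))$, $E_3=E\setminus(X_3\times V)$, $V_3=(V\setminus F_v)\setminus U_3$. If $V_3\ne\emptyset$, call $\texttt{MEC-Decomp-Interleave}(V_3,E_3\cap(V_3\times A\times V_3),v_{\mathrm{arb}})$. The output of a call consists of all graphs output by it and by its recursive calls.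
   Formalization: In step 4 the vertex v' of the last search layer may lie in C_v, hence outside V_2, where the recursive call is ill-defined and could output a spurious graph; the formal algorithm treats a start vertex outside V as v_arb. *)

(* Defs.v *)
(* MathComp world; probabilities are reals of an arbitrary realType. *)
From HB Require Import structures.
From mathcomp Require Import all_boot all_order all_algebra.
From mathcomp Require Import boolp reals.

Set Implicit Arguments.
Unset Strict Implicit.
Unset Printing Implicit Defensive.

Import Order.TTheory GRing.Theory Num.Theory.
Local Open Scope ring_scope.

Record mdp (R : realType) := MDP {
  state : finType;
  action : finType;
  d_init : state -> R;
  delta : state -> action -> state -> R;
  state_gt0 : (0 < #|state|)%N;
  d_init_01 : forall s, 0 <= d_init s <= 1;
  d_init_sum : \sum_s d_init s = 1;
  delta_01 : forall s a t, 0 <= delta s a t <= 1;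
  delta_sum : forall s a, \sum_t delta s a t = 0 \/ \sum_t delta s a t = 1;
  state_enabled : forall s, exists a, \sum_t delta s a t = 1;
  action_enabled : forall a, exists s, \sum_t delta s a t = 1
}.
Arguments state {R} _.
Arguments action {R} _.
Arguments d_init {R} _ _.
Arguments delta {R} _ _ _ _.

Definition enabled (R : realType) (M : mdp R) (s : state M) : {set action M} :=
  [set a | \sum_t delta M s a t == 1].

(* Candidate pairs (T, pi).  The partial map pi : T -> 2^A is extended by the
   empty set outside T (last clause of [sub_mdp]), so that equal pairs are
   Leibniz-equal. *)
Definition pair_of (R : realType) (M : mdp R) : finType :=
  ({set state M} * {ffun state M -> {set action M}})%type.

Definition sub_mdp (R : realType) (M : mdp R) (D : pair_of M) : bool :=
  [&& D.1 != set0,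
      [forall s in D.1, (D.2 s != set0) && (D.2 s \subset enabled s)],
      [forall s in D.1, forall a in D.2 s, forall t,
         (0 < delta M s a t) ==> (t \in D.1)]
    & [forall s, (s \notin D.1) ==> (D.2 s == set0)]].

Definition sa (R : realType) (M : mdp R) (D : pair_of M) :
    {set state M * action M} :=
  [set p | (p.1 \in D.1) && (p.2 \in D.2 p.1)].

Definition included (R : realType) (M : mdp R) (D1 D2 : pair_of M) : bool :=
  (D1.1 \subset D2.1) && [forall s in D1.1, D1.2 s \subset D2.2 s].

(* A labelled graph (V, E); the edge (s, a, t) is the tuple ((s, a), t). *)
Definition graph (R : realType) (M : mdp R) : finType :=
  ({set state M} * {set state M * action M * state M})%type.

Definition graph_of (R : realType) (M : mdp R) (D : pair_of M) : graph M :=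
  (D.1, [set e : state M * action M * state M |
          [&& e.1.1 \in D.1, e.2 \in D.1, e.1.2 \in D.2 e.1.1
            & 0 < delta M e.1.1 e.1.2 e.2]]).

Definition step_in (R : realType) (M : mdp R) (D : pair_of M) :
    rel (state M) :=
  fun s t => [&& s \in D.1, t \in D.1
               & [exists a in D.2 s, 0 < delta M s a t]].

Definition end_component (R : realType) (M : mdp R) (D : pair_of M) : bool :=
  sub_mdp D &&
  [forall s in D.1, forall t in D.1, connect (step_in D) s t].

Definition is_mec (R : realType) (M : mdp R) (D : pair_of M) : bool :=
  end_component D &&
  [forall D' : pair_of M,
     end_component D' ==> included D D' ==> (D' == D)].

(* D is MEC_M(s); such a D need not exist and is unique when it does. *)
Definition is_mec_of (R : realType) (M : mdp R) (s : state M) (D : pair_of M) :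
    bool :=
  is_mec D && (s \in D.1).

Definition mecs (R : realType) (M : mdp R) (S' : {set state M}) :
    {set pair_of M} :=
  [set D | [exists s in S', is_mec_of s D]].

Definition mec_closed (R : realType) (M : mdp R) (D : pair_of M) : Prop :=
  forall s m, s \in D.1 -> is_mec_of s m -> included m D.

Definition rout (R : realType) (M : mdp R) (D : pair_of M)
    (U : {set state M}) : {set state M * action M} :=
  [set p | [&& p.1 \in U, p.2 \in D.2 p.1
             & [exists t in D.1 :\: U, 0 < delta M p.1 p.2 t]]].

Definition attr_states (R : realType) (M : mdp R) (D : pair_of M)
    (X : {set state M * action M}) : {set state M} :=
  [set s in D.1 | [forall a in D.2 s, (s, a) \in X]].

(* The pair (S_i, X_i). *)
Fixpoint attr_seq (R : realType) (M : mdp R) (D : pair_of M)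
    (X : {set state M * action M}) (i : nat) :
    {set state M} * {set state M * action M} :=
  if i is j.+1 then
    let SX := attr_seq D X j in
    let Xi := SX.2 :|: [set p in sa D |
                         [exists t in SX.1, 0 < delta M p.1 p.2 t]] in
    (SX.1 :|: attr_states D Xi, Xi)
  else (attr_states D X, X).

Definition attr (R : realType) (M : mdp R) (D : pair_of M)
    (X : {set state M * action M}) :
    {set state M} * {set state M * action M} :=
  ([set s | `[< exists i, s \in (attr_seq D X i).1 >]],
   [set p | `[< exists i, p \in (attr_seq D X i).2 >]]).

Definition post (R : realType) (M : mdp R) (g : graph M)
    (U : {set state M}) : {set state M} :=
  [set w in g.1 | [exists u in U, exists a, (u, a, w) \in g.2]].

Definition pre (R : realType) (M : mdp R) (g : graph M)
    (U : {set state M}) : {set state M} :=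
  [set w in g.1 | [exists u in U, exists a, (w, a, u) \in g.2]].

(* [while c f x y]: the loop "while c do f", started in x, terminates in y. *)
Inductive while (X : Type) (c : X -> bool) (f : X -> X) : X -> X -> Prop :=
| While_stop x : ~~ c x -> while c f x x
| While_step x y : c x -> while c f (f x) y -> while c f x y.

(* The forward loop, on the variables (F, L0, L1). *)
Definition fwd_step (R : realType) (M : mdp R) (g : graph M)
    (x : {set state M} * {set state M} * {set state M}) :=
  let: (F, _, L1) := x in (F :|: L1, L1, post g L1 :\: (F :|: L1)).

Definition search (R : realType) (M : mdp R) (g : graph M) (v : state M)
    (F L0 C : {set state M}) : Prop :=
  while (fun x => x.2 != set0) (fwd_step g)
        (set0, set0, [set v]) (F, L0, set0) /\
  while (fun B => ~~ (pre g B :&: F \subset B))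
        (fun B => B :|: (pre g B :&: F)) [set v] C.

(* The third argument: [None] is v_arb, [Some v] is {v}. *)
Definition call_args (R : realType) (M : mdp R) : Type :=
  (graph M * option (state M))%type.

(* v is an admissible start vertex for a call on (V, E) with third argument vo.
   The last layer of the forward search may lie inside the SCC C_v, so the
   recursive call on F_v \ C_v can be passed a vertex v' that is not a vertex
   of its graph; such an argument supplies no start vertex in V and is treated
   as v_arb. *)
Definition start_vertex (R : realType) (M : mdp R) (V : {set state M})
    (vo : option (state M)) (v : state M) : Prop :=
  v \in V /\ (forall w, vo = Some w -> w \in V -> v = w).

Definition restrict (R : realType) (M : mdp R)
    (E : {set state M * action M * state M}) (W : {set state M}) :
    {set state M * action M * state M} :=
  E :&: setX (setX W [set: action M]) W.

Definition subcall (R : realType) (M : mdp R) (W : {set state M})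
    (E : {set state M * action M * state M}) (vo : option (state M)) :
    seq (call_args M) :=
  if W == set0 then [::] else [:: ((W, restrict E W), vo)].

Definition scc_output (R : realType) (M : mdp R) (D : pair_of M) (g : graph M)
    (C : {set state M}) : {set graph M} :=
  let: (_, X1) := attr D (rout D C) in
  if X1 == set0 then [set (C, restrict g.2 C)] else set0.

Definition scc_call (R : realType) (M : mdp R) (D : pair_of M) (g : graph M)
    (C : {set state M}) : seq (call_args M) :=
  let: (U1, X1) := attr D (rout D C) in
  if X1 == set0 then [::]
  else subcall (C :\: U1) (g.2 :\: setX X1 g.1) None.

Definition fwd_call (R : realType) (M : mdp R) (g : graph M)
    (F C : {set state M}) (v' : state M) : seq (call_args M) :=
  subcall (F :\: C) g.2 (Some v').

Definition rest_call (R : realType) (M : mdp R) (D : pair_of M) (g : graph M)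
    (F : {set state M}) : seq (call_args M) :=
  let: (U3, X3) := attr D (rout D (g.1 :\: F)) in
  subcall ((g.1 :\: F) :\: U3) (g.2 :\: setX X3 g.1) None.

(* [exec g vo out calls]: one possible execution of the body of a call on
   (g, vo), for some resolution of its arbitrary choices, directly outputs the
   graphs in out and makes the recursive calls listed in calls. *)
Inductive exec (R : realType) (M : mdp R) (g : graph M)
    (vo : option (state M)) : {set graph M} -> seq (call_args M) -> Prop :=
| Exec (D : pair_of M) (v : state M) (F L0 C : {set state M}) (v' : state M) :
    sub_mdp D -> g = graph_of D ->
    start_vertex g.1 vo v ->
    search g v F L0 C ->
    v' \in L0 ->
    exec g vo (scc_output D g C)
      (scc_call D g C ++ fwd_call g F C v' ++ rest_call D g F).

(* [run cs O]: a complete execution of the stack of pending calls cs, including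
   all the recursive calls they make, outputs exactly the graphs in O. *)
Inductive run (R : realType) (M : mdp R) :
    seq (call_args M) -> {set graph M} -> Prop :=
| Run_nil : run [::] set0
| Run_call g vo cs out calls O :
    exec g vo out calls -> run (calls ++ cs) O ->
    run ((g, vo) :: cs) (out :|: O).

Definition mec_decomp_interleave (R : realType) (M : mdp R) (g : graph M)
    (vo : option (state M)) (O : {set graph M}) : Prop :=
  run [:: (g, vo)] O.

(* Whatever the arbitrary choices, the call never gets stuck (its input is the
   graph of a sub-MDP, a start vertex exists, both loops terminate, and the
   last layer is nonempty) and its recursion is finite. *)
Inductive terminates (R : realType) (M : mdp R) :
    graph M -> option (state M) -> Prop :=
| Terminates g vo :
    (exists2 D : pair_of M, sub_mdp D & g = graph_of D) ->
    (exists v, start_vertex g.1 vo v) ->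
    (forall v, start_vertex g.1 vo v ->
       exists F L0 C, search g v F L0 C /\ L0 != set0) ->
    (forall out calls g' vo', exec g vo out calls -> (g', vo') \in calls ->
       terminates g' vo') ->
    terminates g vo.

(* Main.v *)
(* An end-component is strongly connected, so it lies inside, or is disjoint
   from, every set of states closed under successors.  Both F and F \ C are
   closed (C is the part of F that can reach v), so every MEC with a vertex in
   V lies entirely in C, in F \ C or in V \ F.  The attractor of ROut(U)
   contains no state and no state-action pair of an end-component inside U,
   while what it leaves of U is closed under the remaining actions; hence each
   recursive call receives the graph of an MEC-closed sub-MDP whose MECs are
   those of its part of V.  If the attractor for C is empty, C itself is an
   end-component, and it is maximal because V is MEC-closed.  Every recursive
   call has strictly fewer state-action pairs. *)
Require Import Defs.
From mathcomp Require Import all_boot all_order all_algebra.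
From mathcomp Require Import boolp reals.

Set Implicit Arguments.
Unset Strict Implicit.
Unset Printing Implicit Defensive.

Import Order.TTheory GRing.Theory Num.Theory.
Local Open Scope ring_scope.

Section Facts.
Variables (R : realType) (M : mdp R).
Implicit Types (D m : pair_of M) (s t v w : state M) (a : action M).
Implicit Types (U W F C : {set state M}) (X : {set state M * action M}).

(** * Sub-MDPs, their graphs and inclusion *)

Lemma enabled_succ s a : a \in enabled s -> exists t, 0 < delta M s a t.
Proof.
rewrite inE => /eqP sum1; apply/existsP; apply: contraT.
rewrite negb_exists => /forallP noS.
suff: \sum_t delta M s a t = 0 by rewrite sum1 => /eqP; rewrite oner_eq0.
apply: big1 => t _; apply/eqP; move: (noS t).
by have /andP[d0 _] := delta_01 (m := M) s a t; rewrite lt_def d0 andbT negbK.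
Qed.

Lemma sub_mdpP D :
  reflect [/\ D.1 != set0,
              forall s, s \in D.1 -> D.2 s != set0,
              forall s a, s \in D.1 -> a \in D.2 s -> a \in enabled s,
              forall s a t, s \in D.1 -> a \in D.2 s -> 0 < delta M s a t ->
                t \in D.1
            & forall s, s \notin D.1 -> D.2 s = set0]
          (sub_mdp D).
Proof.
apply: (iffP and4P) => [[D0 /forall_inP en /forall_inP cl /forall_inP out]|].
  split=> // [s /en/andP[]//|s a /en/andP[_ /subsetP sub] /sub//||s /out/eqP//].
  by move=> s a t /cl/forall_inP/[apply]/forallP/(_ t)/implyP.
case=> D0 ne en cl out; split=> //.
- apply/forall_inP => s sD; rewrite ne //=.
  by apply/subsetP => a; apply: en.
- apply/forall_inP => s sD; apply/forall_inP => a aD; apply/forallP => t.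
  by apply/implyP; apply: cl aD.
- by apply/forall_inP => s /out ->.
Qed.

Lemma sub_mdp_act D s : sub_mdp D -> s \in D.1 -> exists a, a \in D.2 s.
Proof. by case/sub_mdpP => _ ne _ _ _ /ne /set0Pn. Qed.

(** An enabled action has a successor of positive probability, so each pair of [sa] leaves an edge
    from which it can be read back. This identifies the sub-MDP chosen inside [exec] with the given
    one. *)
Lemma graph_of_inj D1 D2 :
  sub_mdp D1 -> sub_mdp D2 -> graph_of D1 = graph_of D2 -> D1 = D2.
Proof.
suff sub A B : sub_mdp A -> sub_mdp B -> graph_of A = graph_of B ->
    forall s a, a \in A.2 s -> a \in B.2 s.
  move=> s1 s2 e; have [e1 _] := e.
  rewrite [D1]surjective_pairing [D2]surjective_pairing e1; congr pair.
  by apply/ffunP => s; apply/setP => a; apply/idP/idP; apply: sub.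
move=> /sub_mdpP[_ _ en cl out] sB [e1 /setP e2] s a aA.
have sA : s \in A.1 by apply: contraLR aA => /out ->; rewrite inE.
have [t dt] := enabled_succ (en _ _ sA aA).
have := e2 (s, a, t); rewrite !inE /= sA aA dt (cl _ _ _ sA aA dt) /=.
by move/esym/and4P => [].
Qed.

Lemma includedP D1 D2 :
  reflect ((forall s, s \in D1.1 -> s \in D2.1) /\
           (forall s a, s \in D1.1 -> a \in D1.2 s -> a \in D2.2 s))
          (included D1 D2).
Proof.
apply: (iffP andP) => [[/subsetP h1 /forall_inP h2]|[h1 h2]]; split=> //.
- by move=> s a /h2 /subsetP; apply.
- exact/subsetP.
- by apply/forall_inP => s sD; apply/subsetP => a; apply: h2.
Qed.

Lemma included_trans D1 D2 D3 :
  included D1 D2 -> included D2 D3 -> included D1 D3.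
Proof.
move=> /includedP[a1 a2] /includedP[b1 b2]; apply/includedP; split.
  by move=> s /a1 /b1.
by move=> s a sD /(a2 _ _ sD); apply: b2; apply: a1.
Qed.

Lemma included_anti D1 D2 : sub_mdp D1 -> sub_mdp D2 ->
  included D1 D2 -> included D2 D1 -> D1 = D2.
Proof.
move=> /sub_mdpP[_ _ _ _ o1] /sub_mdpP[_ _ _ _ o2].
move=> /includedP[a1 a2] /includedP[b1 b2].
have e1 : D1.1 = D2.1 by apply/setP => s; apply/idP/idP => [/a1|/b1].
rewrite [D1]surjective_pairing [D2]surjective_pairing e1; congr pair.
apply/ffunP => s; have [sD|sD] := boolP (s \in D1.1).
  apply/setP => a; apply/idP/idP; [exact: a2|apply: b2].
  by rewrite -e1.
by rewrite o1 // o2 // -e1.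
Qed.

Lemma included_sa D1 D2 : included D1 D2 -> sa D1 \subset sa D2.
Proof.
move=> /includedP[a1 a2]; apply/subsetP => -[s a]; rewrite !inE /=.
by case/andP => sD aD; rewrite a1 // a2.
Qed.

(** * End-components and maximality *)

Lemma end_component_sub D : end_component D -> sub_mdp D.
Proof. by case/andP. Qed.

Lemma is_mec_end_component D : is_mec D -> end_component D.
Proof. by case/andP. Qed.

Lemma is_mec_max D D' :
  is_mec D -> end_component D' -> included D D' -> D' = D.
Proof. by case/andP => _ /forallP/(_ D')/implyP h /h/implyP h' /h'/eqP. Qed.

Lemma end_component_in_mec D :
  end_component D -> exists2 m, is_mec m & included D m.
Proof.
move=> ecD.
have refl : included D D by apply/includedP; split.
pose P D' := end_component D' && included D D'.
have PD : P D by rewrite /P ecD refl.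
(* Both summands grow under inclusion, so an end-component above a maximiser has the same two
   cardinalities and therefore equals it. *)
pose sz D' := (#|D'.1| + #|sa D'|)%N.
case: (@arg_maxnP _ D P sz PD) => m /andP[ecm Dm] mmax.
exists m => //; rewrite /is_mec ecm /=; apply/forallP => D'.
apply/implyP => ecD'; apply/implyP => mD'; apply/eqP.
have := mmax D'; rewrite /P ecD' (included_trans Dm mD') => /(_ isT).
rewrite /sz => le.
have /includedP[l1 l2] := mD'.
have S1 : m.1 \subset D'.1 by apply/subsetP.
have S2 := included_sa mD'.
have := subset_leq_card S1; have := subset_leq_card S2 => c2 c1.
have le1 : (#|D'.1| <= #|m.1|)%N.
  by rewrite -(leq_add2r #|sa m|); apply: leq_trans le; rewrite leq_add2l.
have le2 : (#|sa D'| <= #|sa m|)%N.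
  by rewrite -(leq_add2l #|m.1|); apply: leq_trans le; rewrite leq_add2r.
have /eqP e1 : m.1 == D'.1 by rewrite eqEcard S1.
have /eqP e2 : sa m == sa D' by rewrite eqEcard S2.
apply: included_anti (end_component_sub ecD') (end_component_sub ecm) _ mD'.
apply/includedP; split=> [s|s a sD aD]; first by rewrite e1.
have : (s, a) \in sa m by rewrite e2 inE /= sD.
by rewrite inE => /andP[].
Qed.

(** * End-components against sets closed under successors *)

Definition step_closed D F : Prop :=
  forall s t, step_in D s t -> s \in F -> t \in F.

Lemma step_in_included D1 D2 s t :
  included D1 D2 -> step_in D1 s t -> step_in D2 s t.
Proof.
move=> /includedP[i1 i2] /and3P[sD tD /exists_inP[a aD d]].
apply/and3P; split; [exact: i1|exact: i1|apply/exists_inP].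
by exists a => //; exact: i2.
Qed.

Lemma end_component_connect m D s t : end_component m -> included m D ->
  s \in m.1 -> t \in m.1 -> connect (step_in D) s t.
Proof.
case/andP=> _ /forall_inP h mD /h/forall_inP/[apply].
by apply: connect_sub => x y xy; apply/connect1/(step_in_included mD).
Qed.

Lemma connect_step_closed D F s t :
  step_closed D F -> connect (step_in D) s t -> s \in F -> t \in F.
Proof.
move=> clF /connectP[p + ->]; elim: p s => //= x p IH s /andP[sx xp] sF.
by apply: IH => //; apply: clF sx sF.
Qed.

Lemma end_component_step_closed m D F s : step_closed D F ->
  end_component m -> included m D -> s \in m.1 -> s \in F -> m.1 \subset F.
Proof.
move=> clF ecm mD sm sF; apply/subsetP => t tm.
exact: connect_step_closed clF (end_component_connect ecm mD sm tm) sF.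
Qed.

(** A state of [m] inside [F] would reach [s] along a path that cannot leave [F]. *)
Lemma end_component_step_closedC m D F s : step_closed D F ->
  end_component m -> included m D -> s \in m.1 -> s \notin F ->
  m.1 \subset D.1 :\: F.
Proof.
move=> clF ecm mD sm sF; apply/subsetP => t tm; rewrite inE andbC.
have /includedP[-> //= _] := mD.
apply: contra sF; apply: connect_step_closed clF _.
exact: end_component_connect ecm mD tm sm.
Qed.

(** * Restriction of a sub-MDP to [W] with the pairs [X] deleted *)

Definition restr D W X : pair_of M :=
  (W, [ffun s => if s \in W then [set a in D.2 s | (s, a) \notin X] else set0]).

Lemma restr_act D W X s a :
  (a \in (restr D W X).2 s) = [&& s \in W, a \in D.2 s & (s, a) \notin X].
Proof. by rewrite ffunE; case: ifP; rewrite !inE. Qed.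

(** Translates the edge deletions of the algorithm into deletions of state-action pairs, so that the
    inputs of recursive calls are graphs of restrictions. *)
Lemma graph_of_restr D W X : W \subset D.1 ->
  graph_of (restr D W X) =
  (W, restrict ((graph_of D).2 :\: setX X (graph_of D).1) W).
Proof.
move=> /subsetP WD; congr pair; apply/setP => -[[s a] t].
rewrite !inE /= restr_act.
case sW: (s \in W) => /=; last by rewrite !andbF.
case tW: (t \in W) => /=; last by rewrite !andbF.
rewrite (WD _ sW) (WD _ tW) /= !andbT.
by rewrite andbAC andbC andbA.
Qed.

Lemma restr_included D W X : W \subset D.1 -> included (restr D W X) D.
Proof.
move=> /subsetP WD; apply/includedP; split=> // s a _.
by rewrite restr_act => /and3P[].
Qed.

Lemma restr_sub_mdp D W X : sub_mdp D -> W \subset D.1 -> W != set0 ->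
  (forall s, s \in W -> exists2 a, a \in D.2 s & (s, a) \notin X) ->
  (forall s a t, s \in W -> a \in D.2 s -> (s, a) \notin X ->
     0 < delta M s a t -> t \in W) ->
  sub_mdp (restr D W X).
Proof.
move=> /sub_mdpP[_ ne en cl out] /subsetP WD W0 ex clW.
apply/sub_mdpP; split=> //=.
- move=> s sW; have [a aD aX] := ex s sW; apply/set0Pn; exists a.
  by rewrite restr_act sW aD.
- by move=> s a sW; rewrite restr_act => /and3P[_ aD _]; apply: en (WD _ sW) aD.
- by move=> s a t sW; rewrite restr_act => /and3P[_ aD aX]; apply: clW.
- by move=> s sW; rewrite ffunE (negPf sW).
Qed.

(** Supplies the decrease for termination: losing the single pair [p] is enough. *)
Lemma restr_sa_lt D W X p : W \subset D.1 ->
  p \in sa D -> (p.1 \notin W) || (p \in X) ->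
  (#|sa (restr D W X)| < #|sa D|)%N.
Proof.
move=> WD pD pW; apply: proper_card; apply/properP; split.
  exact/included_sa/restr_included.
exists p => //; case: p pW {pD} => s a /= pW; rewrite inE restr_act /=.
by apply/negP => /andP[_ /and3P[sW _ aX]]; rewrite sW (negPf aX) in pW.
Qed.

Lemma restr_mec_included D W X m : included m D -> m.1 \subset W ->
  [disjoint sa m & X] -> included m (restr D W X).
Proof.
move=> /includedP[_ i2] /subsetP mW /pred0P dis; apply/includedP; split=> // s a sm am.
rewrite restr_act mW // i2 //=; have := dis (s, a).
by rewrite /= !inE /= sm am /= => ->.
Qed.

Lemma restr_mec_closed D W X : mec_closed D -> W \subset D.1 ->
  (forall m s, is_mec m -> included m D -> s \in m.1 -> s \in W ->
     m.1 \subset W /\ [disjoint sa m & X]) ->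
  mec_closed (restr D W X).
Proof.
move=> mcD /subsetP WD h s m /= sW mm; have mD := mcD s m (WD _ sW) mm.
have [mec sm] := andP mm; have [mW dis] := h m s mec mD sm sW.
exact: restr_mec_included.
Qed.

(** * Attractors and [rout] *)

Lemma attr_seq_stepE D X i :
  (attr_seq D X i).1 = attr_states D (attr_seq D X i).2.
Proof.
have mono (A B : {set state M * action M}) : A \subset B ->
    attr_states D A \subset attr_states D B.
  move=> /subsetP AB; apply/subsetP => s; rewrite !inE => /andP[-> /=].
  by move=> /forall_inP h; apply/forall_inP => a /h /AB.
(* The accumulated states are absorbed, because [attr_states] is monotone and the pair sets
   increase. *)
elim: i => //= i IH; apply/setUidPr; rewrite IH; apply: mono.
exact: subsetUl.
Qed.

Lemma attr_seqS D X i :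
  (attr_seq D X i).2 \subset (attr_seq D X i.+1).2.
Proof. exact: subsetUl. Qed.

Lemma attr_seq_mono D X i j : (i <= j)%N ->
  (attr_seq D X i).2 \subset (attr_seq D X j).2.
Proof.
move=> /subnK <-; elim: (j - i)%N => // k IH.
exact: subset_trans IH (attr_seqS _ _ _).
Qed.

Lemma attr_sub_pairs D X : X \subset (attr D X).2.
Proof. by apply/subsetP => p pX; rewrite inE; apply/asboolP; exists 0%N. Qed.

Lemma attr_pairs_sa D X : X \subset sa D -> (attr D X).2 \subset sa D.
Proof.
move=> /subsetP XD; apply/subsetP => p; rewrite inE => /asboolP[i].
elim: i => [|i IH]; first exact: XD.
by rewrite inE => /orP[/IH//|]; rewrite inE => /andP[].
Qed.

Lemma attr_pairs_succ D X s a t : (s, a) \in sa D -> 0 < delta M s a t ->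
  t \in (attr D X).1 -> (s, a) \in (attr D X).2.
Proof.
move=> sD d; rewrite !inE => /asboolP[i ti]; apply/asboolP; exists i.+1.
by rewrite inE; apply/orP; right; rewrite inE sD; apply/exists_inP; exists t.
Qed.

Lemma attr_states_mem D X s : s \in D.1 ->
  (forall a, a \in D.2 s -> (s, a) \in (attr D X).2) -> s \in (attr D X).1.
Proof.
move=> sD h; rewrite inE; apply/asboolP.
have {}h a : exists i, a \in D.2 s -> (s, a) \in (attr_seq D X i).2.
  have [/h|_] := boolP (a \in D.2 s); last by exists 0%N.
  by rewrite inE => /asboolP[i]; exists i.
have [f fP] := choice h.
(* Each action of [s] enters at its own stage [f a]; the actions being finitely many, the largest
   stage contains them all. *)
exists (\max_a f a)%N; rewrite attr_seq_stepE inE sD /=; apply/forall_inP => a /fP.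
by apply/subsetP/attr_seq_mono/leq_bigmax.
Qed.

(** Induction on the stage. A state of [m] in the attractor would need all its actions, including
    one of [m], to be attracted already; a newly attracted pair of [m] would have an attracted
    successor, which lies in [m] by closure. *)
Lemma attr_disjoint D X m : sub_mdp m -> included m D ->
  [disjoint sa m & X] ->
  [disjoint m.1 & (attr D X).1] /\ [disjoint sa m & (attr D X).2].
Proof.
move=> subm /includedP[i1 i2] dis.
have [_ _ _ cl _] := sub_mdpP _ subm.
have dS i : [disjoint sa m & (attr_seq D X i).2] ->
    [disjoint m.1 & (attr_seq D X i).1].
  rewrite attr_seq_stepE => di; apply/pred0P => s /=; apply/negP => /andP[sm].
  rewrite inE => /andP[_ /forall_inP h].
  have [a am] := sub_mdp_act subm sm.
  have /pred0P/(_ (s, a)) := di; rewrite /= (h _ (i2 _ _ sm am)).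
  by rewrite inE sm am.
have dX i : [disjoint sa m & (attr_seq D X i).2].
  elim: i => // i IH; apply/pred0P => -[s a] /=; apply/negP => /andP[sam].
  rewrite inE => /orP[saX|].
    by have /pred0P/(_ (s, a)) := IH; rewrite /= sam saX.
  rewrite inE => /andP[_ /exists_inP[t tS d]].
  move: sam; rewrite inE => /andP[/= sm am].
  by have /pred0P/(_ t) := dS _ IH; rewrite /= tS (cl _ _ _ sm am d).
split; apply/pred0P => s /=; apply/negP => /andP[sm]; rewrite inE => /asboolP[i].
  by move=> si; have /pred0P/(_ s) := dS _ (dX i); rewrite /= sm si.
by move=> si; have /pred0P/(_ s) := dX i; rewrite /= sm si.
Qed.

Lemma rout_disjoint D U m : sub_mdp m -> m.1 \subset U ->
  [disjoint sa m & rout D U].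
Proof.
move=> /sub_mdpP[_ _ _ cl _] /subsetP mU; apply/pred0P => -[s a] /=.
apply/negP; rewrite !inE /= => /andP[/andP[sm am] /and3P[_ _]].
move=> /exists_inP[t + d]; rewrite inE => /andP[/negP tU _]; apply: tU.
exact/mU/(cl _ _ _ sm am d).
Qed.

Lemma rout_sa D U : U \subset D.1 -> rout D U \subset sa D.
Proof.
move=> /subsetP UD; apply/subsetP => -[s a]; rewrite !inE /=.
by case/and3P => /UD -> ->.
Qed.

(** The invariant preserved by every recursive call. *)
Definition valid D : Prop := sub_mdp D /\ mec_closed D.

Lemma attr_restr_valid D U : valid D -> U \subset D.1 ->
  (forall m s, is_mec m -> included m D -> s \in m.1 -> s \in U ->
     m.1 \subset U) ->
  let A := attr D (rout D U) in U :\: A.1 != set0 ->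
  valid (restr D (U :\: A.1) A.2).
Proof.
move=> [sD mD] UD hU A W0.
have WD : U :\: A.1 \subset D.1 by apply: subset_trans UD; apply: subsetDl.
have /subsetP UD' := UD; have [_ _ _ clD _] := sub_mdpP _ sD.
split.
- apply: restr_sub_mdp => // [s|s a t].
    (* A state all of whose actions are attracted is itself attracted, so a remaining state keeps an
       action. *)
    rewrite in_setD => /andP[sA sU]; apply: contrapT => no.
    case/negP: sA; apply: attr_states_mem; first exact: UD'.
    by move=> a aD; apply: contrapT => /negP aX; apply: no; exists a.
  (* A remaining action cannot enter the attracted states, as its pair would then be attracted, nor
     leave [U], as its pair would then lie in [rout D U]. *)
  rewrite !in_setD => /andP[sA sU] aD aX d; apply/andP; split.
    apply: contra aX; apply: attr_pairs_succ d.
    by rewrite inE /= UD'.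
  apply: contraT => tU; case/negP: aX.
  have /subsetP sub := attr_sub_pairs D (rout D U).
  have -> := sub (s, a); rewrite //.
  rewrite !inE /= sU aD; apply/exists_inP; exists t => //.
  by rewrite inE tU; apply: clD d => //; apply: UD'.
- apply: restr_mec_closed => // m s mec mi sm; rewrite inE => /andP[_ sU].
  have mU := hU m s mec mi sm sU.
  have subm := end_component_sub (is_mec_end_component mec).
  have [d1 d2] := attr_disjoint subm mi (rout_disjoint D subm mU).
  by split=> //; rewrite subsetD mU.
Qed.

Lemma attr_mecs D U : valid D -> U \subset D.1 ->
  (forall m s, is_mec m -> included m D -> s \in m.1 -> s \in U ->
     m.1 \subset U) ->
  mecs (U :\: (attr D (rout D U)).1) = mecs U.
Proof.
move=> [sD mD] /subsetP UD hU; apply/setP => m; rewrite !inE.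
apply/exists_inP/exists_inP => -[s sU mm]; exists s => //.
  by move: sU; rewrite inE => /andP[].
have mi := mD _ _ (UD _ sU) mm; have [mec sm] := andP mm.
have mU := hU m s mec mi sm sU.
have subm := end_component_sub (is_mec_end_component mec).
have [/pred0P/(_ s) /= d1 _] := attr_disjoint subm mi (rout_disjoint D subm mU).
by rewrite inE sU andbT; move: d1; rewrite sm /= => ->.
Qed.

(** * The forward and backward searches *)

Definition reach_spec D v F C : Prop :=
  [/\ v \in C, C \subset F, F \subset D.1, step_closed D F &
    (forall s t, step_in D s t -> s \in F -> t \in C -> s \in C) /\
    (forall s t, s \in C -> t \in C -> connect (step_in D) s t)].

Lemma edge_step D s t : (exists a, (s, a, t) \in (graph_of D).2) <-> step_in D s t.
Proof.
split=> [[a]|/and3P[sD tD /exists_inP[a aD d]]].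
  rewrite inE /= => /and4P[sD tD aD d]; apply/and3P; split=> //.
  by apply/exists_inP; exists a.
by exists a; rewrite inE /= sD tD aD.
Qed.

Lemma postP D U t :
  reflect (exists2 s, s \in U & step_in D s t) (t \in post (graph_of D) U).
Proof.
rewrite inE; apply: (iffP andP) => [[_ /exists_inP[s sU /existsP e]]|[s sU st]].
  by exists s => //; apply/edge_step.
split; first by case/and3P: st.
by apply/exists_inP; exists s => //; apply/existsP/edge_step.
Qed.

Lemma preP D U s :
  reflect (exists2 t, t \in U & step_in D s t) (s \in pre (graph_of D) U).
Proof.
rewrite inE; apply: (iffP andP) => [[_ /exists_inP[t tU /existsP e]]|[t tU st]].
  by exists t => //; apply/edge_step.
split; first by case/and3P: st.
by apply/exists_inP; exists t => //; apply/existsP/edge_step.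
Qed.

Lemma while_inv (T : Type) (c : T -> bool) f (I : T -> Prop) x y :
  (forall z, c z -> I z -> I (f z)) -> while c f x y -> I x -> I y /\ ~~ c y.
Proof.
by move=> h; elim=> {x y} [x nc Ix|x y cx _ IH Ix] //; apply: IH; apply: h.
Qed.

(** The variant [mu] drops at every iteration, hence strong induction on its value. *)
Lemma while_ex (T : Type) (c : T -> bool) f (I : T -> Prop) (mu : T -> nat) x :
  (forall z, c z -> I z -> I (f z)) ->
  (forall z, c z -> I z -> (mu (f z) < mu z)%N) ->
  I x -> exists y, while c f x y.
Proof.
move=> hI hmu; have [n] := ubnP (mu x); elim: n x => // n IH x lt Ix.
have [cx|ncx] := boolP (c x); last by exists x; constructor.
have [|y xy] := IH (f x) _ (hI _ cx Ix).
  exact: leq_trans (hmu _ cx Ix) lt.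
by exists y; apply: While_step.
Qed.

(** At exit [L1] is empty, so the fourth clause makes [F] closed and the last disjunction makes [L0]
    nonempty; it is a disjunction because [L0] starts empty. Disjointness of [F] and [L1] makes each
    iteration enlarge [F]. *)
Definition fwd_inv D v (x : {set state M} * {set state M} * {set state M}) :=
  let: (F, L0, L1) := x in
  [/\ v \in F :|: L1, F :|: L1 \subset D.1,
      forall t, t \in F :|: L1 -> connect (step_in D) v t,
      forall s t, step_in D s t -> s \in F -> t \in F :|: L1 &
      [disjoint F & L1] /\ ((L0 != set0) || (L1 != set0))].

Lemma fwd_inv_step D v x : x.2 != set0 ->
  fwd_inv D v x -> fwd_inv D v (fwd_step (graph_of D) x).
Proof.
case: x => -[F L0] L1 /= L10 [vF /subsetP FD co st [dis _]].
split; last first.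
- by rewrite L10; split=> //; rewrite disjoint_sym disjoints_subset subsetDr.
- move=> s t stp sF; rewrite in_setU in_setD.
  (* A new successor has its source in [L1], since successors of [F] are already covered by the
     invariant. *)
  have [//|tFL /=] := boolP (t \in F :|: L1).
  apply/postP; exists s => //; case/setUP: sF => //.
  by move/(st _ _ stp); rewrite (negPf tFL).
- move=> t /setUP[/co//|/setDP[/postP[s sL stp] _]].
  by apply: connect_trans (connect1 stp); apply: co; rewrite inE sL orbT.
- by apply/subsetP => t /setUP[/FD//|/setDP[/postP[s _ /and3P[]]]].
- by rewrite inE vF.
Qed.

Lemma fwd_inv_init D v : v \in D.1 -> fwd_inv D v (set0, set0, [set v]).
Proof.
move=> vD; split; rewrite ?set0U ?sub1set ?inE ?eqxx //.
- by move=> t; rewrite inE => /eqP ->.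
- by move=> s t _; rewrite in_set0.
- rewrite disjoints_subset sub0set; split=> //; apply/orP; right.
  by apply/set0Pn; exists v; rewrite inE.
Qed.

Lemma search_spec D v F L0 C : v \in D.1 ->
  search (graph_of D) v F L0 C -> reach_spec D v F C.
Proof.
move=> vD [/(while_inv (I := fwd_inv D v)) H wC].
have [||[]] := H; [exact: fwd_inv_step|exact: fwd_inv_init|].
rewrite setU0 => vF FD co clF _ _.
(* Invariant of the backward loop: everything collected reaches [v]. The negated guard then gives
   backward closure within [F]. *)
pose I (B : {set state M}) := [/\ v \in B, B \subset F & forall s, s \in B -> connect (step_in D) s v].
have [||[vC CF coC]] := while_inv (I := I) _ wC.
- move=> B _ [vB BF coB]; split.
  + by rewrite inE vB.
  + by rewrite subUset BF subsetIr.
  + move=> s /setUP[/coB//|/setIP[/preP[t tB st] _]].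
    exact: connect_trans (connect1 st) (coB _ tB).
- by split; rewrite ?inE ?sub1set // => s; rewrite inE => /eqP ->.
rewrite negbK => /subsetP clC.
split=> //; split=> [s t st sF tC|s t sC tC].
  by apply: clC; rewrite inE sF andbT; apply/preP; exists t.
(* Two states of [C] are joined through [v]: [s] reaches [v], and [v] reaches [t] because [t] is in
   [F]. *)
apply: connect_trans (coC _ sC) (co _ _); exact: (subsetP CF).
Qed.


Lemma search_exists D v : v \in D.1 ->
  exists F L0 C, search (graph_of D) v F L0 C /\ L0 != set0.
Proof.
move=> vD.
(* The complement of [F] shrinks by the nonempty [L1]; likewise for the complement of [B] below. *)
pose mu (x : {set state M} * {set state M} * {set state M}) := #|~: x.1.1|.
have [|[[F L0] L1] wF] := while_ex (mu := mu) (@fwd_inv_step D v) _ (fwd_inv_init vD).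
  case=> -[F L0] L1 /= /set0Pn[t tL] [_ _ _ _ [dis _]].
  apply/proper_card/properP; split; first by rewrite setCS subsetUl.
  have /pred0P/(_ t) := dis; rewrite /= tL andbT => tF.
  by exists t; rewrite !inE ?tF ?tL ?orbT.
have [[_ _ _ _ [_ LL]]] := while_inv (@fwd_inv_step D v) wF (fwd_inv_init vD).
rewrite /= negbK => /eqP L10; rewrite L10 eqxx orbF in LL wF.
pose muC (B : {set state M}) := #|~: B|.
pose c (B : {set state M}) := ~~ (pre (graph_of D) B :&: F \subset B).
pose f (B : {set state M}) := B :|: (pre (graph_of D) B :&: F).
have [//||//|C wC] := while_ex (c := c) (f := f) (I := fun=> True) (mu := muC)
  (x := [set v]).
- move=> B /subsetPn[t tP tB] _; apply/proper_card/properP; split.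
    by rewrite setCS subsetUl.
  by exists t; rewrite !in_setC ?tB // in_setU tP orbT.
by exists F, L0, C.
Qed.

(** * The three regions [C], [F :\: C] and [D.1 :\: F] *)

Section Reach.
Variables (D : pair_of M) (v : state M) (F C : {set state M}).
Hypothesis spec : reach_spec D v F C.

Lemma reach_diff_closed : step_closed D (F :\: C).
Proof.
have [_ _ _ clF [clC _]] := spec.
move=> s t st /setDP[sF sC]; apply/setDP; split; first exact: clF st sF.
by apply: contra sC; apply: clC st sF.
Qed.

(** Closure of [F] puts [m] inside [F]; a state of [m] outside [C] would lie in the closed set
    [F :\: C] and drag [s] there too. *)
Lemma reach_scc_mec m s : is_mec m -> included m D -> s \in m.1 -> s \in C ->
  m.1 \subset C.
Proof.
have [_ /subsetP CF _ clF _] := spec.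
move=> /is_mec_end_component ec mD sm sC.
have /subsetP mF := end_component_step_closed clF ec mD sm (CF _ sC).
apply/subsetP => t tm; apply: contraT => tC.
have tFC : t \in F :\: C by apply/setDP; split=> //; apply: mF.
have /subsetP/(_ s sm) := end_component_step_closed reach_diff_closed ec mD tm tFC.
by rewrite in_setD sC.
Qed.

Lemma reach_diff_mec m s : is_mec m -> included m D -> s \in m.1 ->
  s \in F :\: C -> m.1 \subset F :\: C.
Proof.
move=> /is_mec_end_component; exact: end_component_step_closed reach_diff_closed.
Qed.

Lemma reach_rest_mec m s : is_mec m -> included m D -> s \in m.1 ->
  s \in D.1 :\: F -> m.1 \subset D.1 :\: F.
Proof.
have [_ _ _ clF _] := spec.
move=> /is_mec_end_component ec mD sm /setDP[_].
exact: end_component_step_closedC clF ec mD sm.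
Qed.

Lemma reach_vertices : D.1 = C :|: ((F :\: C) :|: (D.1 :\: F)).
Proof.
have [_ /subsetP CF /subsetP FD _ _] := spec; apply/setP => s; rewrite !inE.
have := CF s; have := FD s.
by case: (s \in C); case: (s \in F); case: (s \in D.1) => //= h h';
  first [have := h isT|have := h' isT].
Qed.

Lemma rout0_succ s a t : rout D C = set0 -> sub_mdp D ->
  s \in C -> a \in D.2 s -> 0 < delta M s a t -> t \in C.
Proof.
have [_ /subsetP CF /subsetP FD _ _] := spec.
move=> r0 /sub_mdpP[_ _ _ cl _] sC aD d; apply: contraT => tC.
have : (s, a) \in rout D C.
  rewrite inE /= sC aD; apply/exists_inP; exists t => //.
  by rewrite inE tC; apply: cl aD d; apply/FD/CF.
by rewrite r0 inE.
Qed.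

(** With [rout D C] empty no action leaves [C], so a path of [D] joining two states of [C] is also a
    path of the restriction. *)
Lemma scc_restr_end_component : rout D C = set0 -> sub_mdp D ->
  end_component (restr D C set0).
Proof.
have [vC CF FD _ [_ conn]] := spec; have CD := subset_trans CF FD.
move=> r0 sD; apply/andP; split.
  apply: restr_sub_mdp => // [|s sC|s a t sC aD _ d].
  - by apply/set0Pn; exists v.
  - have [a aD] := sub_mdp_act sD (subsetP CD _ sC).
    by exists a => //; rewrite inE.
  - exact: rout0_succ aD d.
apply/forall_inP => s /= sC; apply/forall_inP => t /= tC.
have /connectP[p + ->] := conn _ _ sC tC.
elim: p s sC => //= x p IH s sC /andP[/and3P[_ _ /exists_inP[a aD d]] xp].
have xC := rout0_succ r0 sD sC aD d.
apply: connect_trans (connect1 _) (IH _ xC xp).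
by apply/and3P; split=> //; apply/exists_inP; exists a; rewrite ?restr_act ?sC ?aD ?inE.
Qed.

(** By MEC-closedness, every MEC meeting [C] lies in [D], hence in [K]. The MEC above [K] contains
    [v], so it also lies in [K] and equals it. *)
Lemma scc_mecs : rout D C = set0 -> valid D -> mecs C = [set restr D C set0].
Proof.
have [vC CF FD _ _] := spec; have /subsetP CD := subset_trans CF FD.
move=> r0 [sD mD]; pose K := restr D C set0.
have ecK : end_component K := scc_restr_end_component r0 sD.
have leK m s : is_mec m -> s \in m.1 -> s \in C -> included m K.
  move=> mec sm sC; have mi : included m D.
    by apply: mD (CD _ sC) _; rewrite /is_mec_of mec.
  apply: restr_mec_included mi (reach_scc_mec mec mi sm sC) _.
  by rewrite disjoint_sym disjoints_subset sub0set.
have mecK : is_mec K.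
  have [m mec Km] := end_component_in_mec ecK.
  have vm : v \in m.1 by case/includedP: Km => h _; apply: h.
  suff -> : K = m by [].
  apply: included_anti Km (leK _ _ mec vm vC); first exact: end_component_sub ecK.
  exact/end_component_sub/is_mec_end_component.
apply/setP => m; rewrite !inE; apply/exists_inP/eqP => [[s sC /andP[mec sm]]|->].
  exact/esym/(is_mec_max mec ecK)/(leK _ _ mec sm sC).
by exists v => //; rewrite /is_mec_of mecK.
Qed.

End Reach.

(** * Specified outputs of call lists and correctness of one call *)

Definition mec_graphs U : {set graph M} := [set graph_of m | m in mecs U].

Lemma mec_graphs0 : mec_graphs set0 = set0.
Proof.
rewrite /mec_graphs; suff -> : mecs set0 = set0 :> {set pair_of M} by rewrite imset0.
by apply/setP => m; rewrite !inE; apply/exists_inP => -[s]; rewrite inE.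
Qed.

Lemma mec_graphsU U W : mec_graphs (U :|: W) = mec_graphs U :|: mec_graphs W.
Proof.
rewrite /mec_graphs -imsetU.
suff -> : mecs (U :|: W) = mecs U :|: mecs W by [].
apply/setP => m; rewrite !inE.
apply/exists_inP/orP => [[s /setUP[sU|sW] ms]|[/exists_inP[s sU ms]|/exists_inP[s sU ms]]].
- by left; apply/exists_inP; exists s.
- by right; apply/exists_inP; exists s.
- by exists s => //; rewrite inE sU.
- by exists s => //; rewrite inE sU orbT.
Qed.

Definition calls_mecs (cs : seq (call_args M)) : {set graph M} :=
  \bigcup_(c <- cs) mec_graphs c.1.1.

Lemma calls_mecs_cat cs1 cs2 :
  calls_mecs (cs1 ++ cs2) = calls_mecs cs1 :|: calls_mecs cs2.
Proof. exact: big_cat. Qed.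

Lemma calls_mecs_subcall U E vo : calls_mecs (subcall U E vo) = mec_graphs U.
Proof.
rewrite /calls_mecs /subcall; case: eqP => [->|_]; last by rewrite big_seq1.
by rewrite big_nil mec_graphs0.
Qed.

Lemma mem_subcall U E vo g' vo' :
  (g', vo') \in subcall U E vo -> U != set0 /\ g' = (U, restrict E U).
Proof. by rewrite /subcall; case: ifP => // /negbT U0; rewrite inE => /eqP[->]. Qed.

Definition smaller_input D (g : graph M) : Prop :=
  exists D', [/\ g = graph_of D', valid D' & (#|sa D'| < #|sa D|)%N].

Lemma graph_of_restr0 D W : W \subset D.1 ->
  graph_of (restr D W set0) = (W, restrict (graph_of D).2 W).
Proof.
move=> WD; rewrite graph_of_restr //; congr (_, restrict _ _).
by apply/setP => e; rewrite !inE.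
Qed.

(** Shared by the calls on [C] and on the rest: [p] is a deleted pair, attracted in the former case
    and outside [U] in the latter. *)
Lemma attr_subcall_smaller D U p vo g' vo' : valid D -> U \subset D.1 ->
  (forall m s, is_mec m -> included m D -> s \in m.1 -> s \in U ->
     m.1 \subset U) ->
  let A := attr D (rout D U) in
  p \in sa D -> (p.1 \notin U) || (p \in A.2) ->
  (g', vo') \in
    subcall (U :\: A.1) ((graph_of D).2 :\: setX A.2 (graph_of D).1) vo ->
  smaller_input D g'.
Proof.
move=> vD UD hU A pD pU /mem_subcall[W0 ->].
have WD : U :\: A.1 \subset D.1 by apply: subset_trans UD; apply: subsetDl.
exists (restr D (U :\: A.1) A.2); split; first by rewrite graph_of_restr.
- exact: attr_restr_valid.
- apply: restr_sa_lt WD pD _; case/orP: pU => [pU|->]; last by rewrite orbT.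
  by rewrite in_setD negb_and pU orbT.
Qed.

Lemma exec_correct D vo out calls :
  valid D -> exec (graph_of D) vo out calls ->
  (forall g' vo', (g', vo') \in calls -> smaller_input D g') /\
  out :|: calls_mecs calls = mec_graphs D.1.
Proof.
move=> vD ex; have [sD mD] := vD.
case: ex => D0 v F L0 C v' sD0 /(graph_of_inj sD sD0) <-{D0 sD0}.
move=> [vDin _] /(search_spec vDin) spec _.
have [vC CF FD clF _] := spec; have CD := subset_trans CF FD.
have vF := subsetP CF _ vC.
(* Since [v] is in [C] and in [F], the pair [(v, a)] is lost by the other two calls. *)
have [a va] := sub_mdp_act sD vDin.
have vaD : (v, a) \in sa D by rewrite inE vDin.
have RD : D.1 :\: F \subset D.1 := subsetDl _ _.
have mecC := reach_scc_mec spec; have mecR := reach_rest_mec spec.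
split.
- move=> g' vo'; rewrite !mem_cat => /or3P[||].
  + rewrite /scc_call; case eA: (attr _ _) => [U1 X1].
    case: ifP => // /negbT/set0Pn[p pX].
    have pD : p \in sa D.
      have /subsetP := attr_pairs_sa (rout_sa CD).
      by apply; rewrite eA.
    have := @attr_subcall_smaller D C p None g' vo' vD CD mecC.
    by rewrite eA /= pX orbT; apply.
  (* As [F :\: C] is closed under all actions, nothing has to be deleted: [X] is empty. *)
  + move=> /mem_subcall[W0 ->].
    have WD : F :\: C \subset D.1 by apply: subset_trans FD; apply: subsetDl.
    exists (restr D (F :\: C) set0); split; first by rewrite graph_of_restr0.
    * split.
        apply: restr_sub_mdp => // [s sW|s b t sW bD _ d].
          have [b bD] := sub_mdp_act sD (subsetP WD _ sW).
          by exists b => //; rewrite inE.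
        have [_ _ _ cl _] := sub_mdpP _ sD.
        have sDin := subsetP WD _ sW.
        apply: (reach_diff_closed spec) sW; apply/and3P; split=> //.
          exact: cl bD d.
        by apply/exists_inP; exists b.
      apply: restr_mec_closed => // m s mec mi sm sW; split.
        exact: reach_diff_mec spec _ _ mec mi sm sW.
      by rewrite disjoint_sym disjoints_subset sub0set.
    * by apply: restr_sa_lt WD vaD _; rewrite /= in_setD vC.
  + rewrite /rest_call; case eA: (attr _ _) => [U3 X3].
    have := @attr_subcall_smaller D (D.1 :\: F) (v, a) None g' vo' vD RD mecR.
    by rewrite eA /= in_setD vF; apply.
- rewrite !calls_mecs_cat calls_mecs_subcall setUA.
  rewrite (reach_vertices spec) !mec_graphsU; congr (_ :|: (_ :|: _)).
  + have := attr_mecs vD CD mecC; have := attr_sub_pairs D (rout D C).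
    (* Exactly one side contributes: the direct output when [X1], and with it [rout D C], is empty;
       otherwise the call on [C :\: U1], which has the same MECs as [C]. *)
    rewrite /scc_output /scc_call; case: (attr _ _) => [U1 X1] /=.
    case: ifP => [/eqP ->|_] rX eqm.
      have /eqP r0 : rout D C == set0 by rewrite -subset0.
      rewrite /mec_graphs (scc_mecs spec r0 vD) imset_set1 graph_of_restr0 //.
      by rewrite /calls_mecs big_nil setU0.
    by rewrite set0U calls_mecs_subcall /mec_graphs eqm.
  + have := attr_mecs vD RD mecR; rewrite /rest_call.
    by case: (attr _ _) => [U3 X3] /= eqm; rewrite calls_mecs_subcall /mec_graphs eqm.
Qed.

(** * Termination and complete runs *)

Lemma start_vertex_exists U vo : U != set0 -> exists v, start_vertex U vo v.
Proof.
move=> /set0Pn[u uU]; case: vo => [w|]; last by exists u; split.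
have [wU|wU] := boolP (w \in U); first by exists w; split=> // x [->].
(* An argument outside [U] leaves the choice free. *)
by exists u; split=> // x [<-]; rewrite (negPf wU).
Qed.

Lemma valid_terminates D vo : valid D -> terminates (graph_of D) vo.
Proof.
have [n] := ubnP #|sa D|; elim: n D vo => [|n IH] D vo; first by rewrite ltn0.
rewrite ltnS => le vD.
have [sD _] := vD; constructor.
- by exists D.
- by apply: start_vertex_exists; case/sub_mdpP: sD.
- by move=> v [vin _]; apply: search_exists.
- move=> out calls g' vo' /(exec_correct vD)[h _] /h[D' [-> vD' lt]].
  exact: IH (leq_trans lt le) vD'.
Qed.

Lemma terminates_run (g : graph M) vo (cs : seq (call_args M)) O :
  terminates g vo -> run cs O ->
  exists O', run ((g, vo) :: cs) O'.
Proof.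
move=> t; elim: t cs O => {g vo} g vo [D sD eg] [v sv] search_ex _ IH cs O rO.
have [F [L0 [C [sch /set0Pn[v' v'L]]]]] := search_ex v sv.
have ex := Exec sD eg sv sch v'L.
set calls := (_ ++ _) in ex; set out := scc_output _ _ _ in ex.
suff [O' rO'] : exists O', run (calls ++ cs) O'.
  by exists (out :|: O'); apply: Run_call ex rO'.
have : {subset calls <= calls} by [].
(* Runs are built from the bottom of the stack up; keeping the full list on the right of [sub] lets
   the termination hypothesis apply to each call. *)
elim: {1 3}calls => [|[g' vo'] l IHl] sub; first by exists O.
have [c cl|O' rO'] := IHl; first by apply: sub; rewrite inE cl orbT.
by apply: IH ex _ _ _ rO'; apply: sub; rewrite inE eqxx.
Qed.

(** Executing the top call replaces its specified output by its direct output and the specified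
    outputs of its recursive calls, which leaves the union unchanged. *)
Lemma run_mecs (cs : seq (call_args M)) O : run cs O ->
  (forall g vo, (g, vo) \in cs -> exists2 D, g = graph_of D & valid D) ->
  O = calls_mecs cs.
Proof.
elim=> {cs O} [_|g vo cs out calls O ex _ IH vcs].
  by rewrite /calls_mecs big_nil.
have [|D eg vD] := vcs g vo; first by rewrite inE eqxx.
rewrite {}eg in ex vcs *.
have [small eqm] := exec_correct vD ex.
rewrite IH => [|g' vo'].
  by rewrite calls_mecs_cat setUA eqm /calls_mecs big_cons.
rewrite mem_cat => /orP[/small[D' [-> vD' _]]|c]; first by exists D'.
by apply: (vcs g' vo'); rewrite inE c orbT.
Qed.

End Facts.

Theorem theorem2 (R : realType) (M : mdp R) (D : pair_of M)
    (vo : option (state M)) :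
  sub_mdp D -> mec_closed D ->
  (vo = None \/ exists2 v, vo = Some v & v \in (graph_of D).1) ->
  terminates (graph_of D) vo /\
  (forall O : {set graph M},
     mec_decomp_interleave (graph_of D) vo O <->
     O = [set graph_of m | m in mecs D.1]).
Proof.
move=> sD mD _; have vD : valid D by split.
have tD := valid_terminates vo vD; split=> //.
have sound O : mec_decomp_interleave (graph_of D) vo O -> O = mec_graphs D.1.
  move=> /run_mecs ->; first by rewrite /calls_mecs big_seq1.
  by move=> g vo'; rewrite inE => /eqP[-> _]; exists D.
move=> O; split=> [/sound//|->].
(* Some complete run exists, and soundness forces its output to be the specified set, which is
   therefore attained. *)
have [O' rO'] := terminates_run tD (Run_nil M).
by rewrite -[X in mec_decomp_interleave _ _ X](sound _ rO').
Qed.
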